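(* The following statements are equivalent: (i) $\mathcal{H}\cap(\{0_Z\}\times\mathbb{R})=\mathcal{N}\cap(\{0_Z\}\times\mathbb{R})$; (ii) $\min\{\langle x,c\rangle: Ax-b\in Q,\ x\in P\}=\sup\{\langle b,w\rangle:-A^*w+c\in P^*,\ w\in Q^*\}$, where writing $\min$ means that the infimum is attained at some feasible $x$.
   Context: Setting: $(X,Y)$ and $(Z,W)$ are separated dual pairs of real vector spaces, i.e. there are bilinear forms on $X\times Y$ and on $Z\times W$, both denoted $\langle\cdot,\cdot\rangle$, such that $\langle x_0,y\rangle=0$ for all $y\in Y$ implies $x_0=0$, and $\langle x,y_0\rangle=0$ for all $x\in X$ implies $y_0=0$ (and likewise for $(Z,W)$). No topology is assumed. $A:X\to Z$ is a linear map with adjoint $A^*:W\to Y$, a linear map satisfying $\langle x,A^*w\rangle=\langle Ax,w\rangle$ for all $x\in X$, $w\in W$ (assumed to exist). $P\subset X$ and $Q\subset Z$ are convex cones (nonempty, and $\alpha u+\beta v$ is in the cone for all $\alpha,\beta\ge 0$ and $u,v$ in the cone); $b\in Z$, $c\in Y$. Dual cones: $P^*=\{y\in Y:\langle x,y\rangle\ge 0\ \forall x\in P\}$, $Q^*=\{w\in W:\langle q,w\rangle\ge 0\ \forall q\in Q\}$. Feasible sets: $F(\mathcal{P})=\{x\in P: Ax-b\in Q\}$ and $F(\mathcal{D})=\{w\in Q^*:-A^*w+c\in P^*\}$; both are assumed nonempty. Definitions: $\mathcal{H}=\bigcup_{x\in P}\big((Ax-b-Q)\times[\langle x,c\rangle,+\infty[\big)\subset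 Z\times\mathbb{R}$; $v_{\mathcal{D}}(z)=\sup\{\langle b+z,w\rangle:w\in F(\mathcal{D})\}$ for $z\in Z$ (possibly $+\infty$); $\mathcal{N}=\mathrm{epi}\,v_{\mathcal{D}}=\{(z,r)\in Z\times\mathbb{R}: v_{\mathcal{D}}(z)\le r\}$. $0_Z$ is the zero vector of $Z$. *)

(* Defs.v *)
From HB Require Import structures.
From mathcomp Require Import all_boot all_order all_algebra.
From mathcomp Require Import mathcomp_extra boolp classical_sets set_interval.
From mathcomp Require Import reals constructive_ereal ereal.

Set Implicit Arguments.
Unset Strict Implicit.
Unset Printing Implicit Defensive.

Import Order.TTheory GRing.Theory Num.Theory.

Local Open Scope classical_set_scope.
Local Open Scope ring_scope.

Section DualPairs.
Context {R : realType}.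

Definition separated_pairing (X Y : lmodType R)
    (f : {bilinear X -> Y -> R | *%R & *%R}) : Prop :=
  (forall x0, (forall y, f x0 y = 0) -> x0 = 0) /\
  (forall y0, (forall x, f x y0 = 0) -> y0 = 0).

Definition is_adjoint (X Y Z W : lmodType R)
    (pXY : {bilinear X -> Y -> R | *%R & *%R})
    (pZW : {bilinear Z -> W -> R | *%R & *%R})
    (A : {linear X -> Z}) (Aadj : {linear W -> Y}) : Prop :=
  forall x w, pXY x (Aadj w) = pZW (A x) w.

Definition convex_cone (X : lmodType R) (C : set X) : Prop :=
  C !=set0 /\
  forall (a b : R) (u v : X),
    0 <= a -> 0 <= b -> C u -> C v -> C (a *: u + b *: v).

Definition dual_cone (X Y : lmodType R)
    (f : {bilinear X -> Y -> R | *%R & *%R}) (C : set X) : set Y :=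
  [set y | forall x, C x -> 0 <= f x y].

Definition epigraph (T : Type) (f : T -> \bar R) : set (T * R) :=
  [set p | (f p.1 <= p.2%:E)%E].

End DualPairs.

Section ConicProgram.
Context {R : realType} {X Y Z W : lmodType R}.
Variables (pXY : {bilinear X -> Y -> R | *%R & *%R}).
Variables (pZW : {bilinear Z -> W -> R | *%R & *%R}).
Variables (A : {linear X -> Z}) (Aadj : {linear W -> Y}).
Variables (P : set X) (Q : set Z) (b : Z) (c : Y).

Definition primal_feasible : set X := [set x | P x /\ Q (A x - b)].

Definition dual_feasible : set W :=
  [set w | dual_cone pZW Q w /\ dual_cone pXY P (- Aadj w + c)].

Definition primal_value : \bar R :=
  ereal_inf [set (pXY x c)%:E | x in primal_feasible].

Definition dual_value : \bar R :=
  ereal_sup [set (pZW b w)%:E | w in dual_feasible].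

Definition primal_attained : Prop :=
  exists2 x, primal_feasible x & (pXY x c)%:E = primal_value.

Definition calH : set (Z * R) :=
  \bigcup_(x in P)
    ([set A x - b - q | q in Q] `*` [set` `[pXY x c, +oo[%R]).

Definition perturbed_dual_value (z : Z) : \bar R :=
  ereal_sup [set (pZW (b + z) w)%:E | w in dual_feasible].

Definition calN : set (Z * R) := epigraph perturbed_dual_value.

End ConicProgram.

(* Main.v *)
Require Import Defs.
From HB Require Import structures.
From mathcomp Require Import all_boot all_order all_algebra.
From mathcomp Require Import mathcomp_extra boolp classical_sets set_interval.
From mathcomp Require Import reals constructive_ereal ereal.

Set Implicit Arguments.
Unset Strict Implicit.
Unset Printing Implicit Defensive.

Import Order.TTheory GRing.Theory Num.Theory.

Local Open Scope classical_set_scope.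
Local Open Scope ring_scope.

(** Both sides of the first condition are sets of pairs [(0, r)], so they
    compare as sets of reals.  On the vertical axis, [calH] is the up-set
    generated by the objective values of the primal feasible points
    ([calH_axis]), and [calN] is the closed half-line above the dual value
    ([calN_axis]).  The first condition thus says that
    - every primal feasible value is at least the dual value, and
    - every real upper bound of the dual value is at least some primal
      feasible value.
    Dual feasibility keeps the dual value above [-oo], and the first clause at a
    primal feasible point keeps it below [+oo]; being real, it may be taken as
    the upper bound in the second clause.  The feasible point obtained there has
    exactly the dual value as its objective, and by the
    first clause it is a minimizer.  Conversely, if a minimizer has the dual
    value as its objective, then the up-set generated by the primal values is
    the closed half-line above that number.  This equivalence, for an arbitrary
    real function on a nonempty set, is [upset_eq_ray]. *)

Section AxisSlices.
Context {R : realType} {X Y Z W : lmodType R}.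
Variables (pXY : {bilinear X -> Y -> R | *%R & *%R}).
Variables (pZW : {bilinear Z -> W -> R | *%R & *%R}).
Variables (A : {linear X -> Z}) (Aadj : {linear W -> Y}).
Variables (P : set X) (Q : set Z) (b : Z) (c : Y).

(** The only way for [A x - b - q] to vanish is [q = A x - b], so membership of
    this point in [Q] is exactly primal feasibility. *)
Lemma calH_axis (r : R) :
  calH pXY A P Q b c (0, r) <->
  exists2 x, primal_feasible A P Q b x & pXY x c <= r.
Proof.
split=> [[x Px [/= [q Qq /eqP]]]|[x [Px Qx] xr]].
  rewrite subr_eq0 => /eqP Aq; rewrite in_itv/= andbT => xr.
  by exists x => //; split=> //; rewrite Aq.
exists x => //; split=> /=; last by rewrite in_itv/= andbT.
by exists (A x - b) => //; rewrite subrr.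
Qed.

Lemma calN_axis (r : R) :
  calN pXY pZW Aadj P Q b c (0, r) <->
  (dual_value pXY pZW Aadj P Q b c <= r%:E)%E.
Proof. by rewrite /calN /epigraph /perturbed_dual_value /= addr0. Qed.

End AxisSlices.

Lemma setI_axis_eq (R : realType) (Z : lmodType R) (S T : set (Z * R)) :
  S `&` ([set 0] `*` [set: R]) = T `&` ([set 0] `*` [set: R]) <->
  forall r, S (0, r) <-> T (0, r).
Proof.
split=> [ST r|ST].
  have := congr1 (fun U : set (Z * R) => U (0, r)) ST.
  rewrite /setI /setX /= => STr.
  split=> [Sr|Tr].
    by have [] : T (0, r) /\ 0 = 0 :> Z /\ True by rewrite -STr.
  by have [] : S (0, r) /\ 0 = 0 :> Z /\ True by rewrite STr.
apply/seteqP; split=> -[z r] /= [zr [/= z0 _]]; rewrite z0 in zr *;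
  by split=> //; apply/ST.
Qed.

(** A closed half-line of reals contains its endpoint, so an up-set generated by
    values of [f] fills such a half-line only if the endpoint is itself a value
    of [f], hence the least one.  The value [-oo] is excluded for [d] because
    the half-line would then be all of [R], which is the up-set of any [f]
    unbounded below although no minimum exists; [+oo] would give an empty
    half-line, which the nonempty [D] rules out. *)
Lemma upset_eq_ray (R : realType) (T : Type) (D : set T) (f : T -> R)
    (d : \bar R) :
  D !=set0 -> d != -oo%E ->
  (forall r, (exists2 x, D x & f x <= r) <-> (d <= r%:E)%E) <->
  (exists2 x, D x & (f x)%:E = ereal_inf [set (f y)%:E | y in D]) /\
    ereal_inf [set (f y)%:E | y in D] = d.
Proof.
move=> [x0 Dx0] dNy; split=> [ray|[[m Dm fm] infd] r].
  have lower x : D x -> (d <= (f x)%:E)%E by move=> Dx; apply/ray; exists x.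
  case: d => [d||] // in dNy ray lower *; last by have := lower _ Dx0.
  (* The endpoint [d] of the half-line lies in the up-set. *)
  have [m Dm fmd] : exists2 x, D x & f x <= d by apply/ray.
  have fmE : f m = d by apply/eqP; rewrite eq_le fmd -lee_fin lower.
  have infE : ereal_inf [set (f y)%:E | y in D] = d%:E.
    apply/eqP; rewrite eq_le; apply/andP; split.
      by apply: ereal_inf_lbound; exists m => //; rewrite fmE.
    by apply: le_ereal_inf_tmp => _ [x Dx <-]; exact: lower.
  by split=> //; exists m => //; rewrite fmE infE.
rewrite -infd; split=> [[x Dx fxr]|].
  apply: (@le_trans _ _ (f x)%:E); last by rewrite lee_fin.
  by apply: ereal_inf_lbound; exists x.
by rewrite -fm lee_fin => fmr; exists m.
Qed.

Theorem theorem4p6 (R : realType) (X Y Z W : lmodType R)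
    (pXY : {bilinear X -> Y -> R | *%R & *%R})
    (pZW : {bilinear Z -> W -> R | *%R & *%R})
    (A : {linear X -> Z}) (Aadj : {linear W -> Y})
    (P : set X) (Q : set Z) (b : Z) (c : Y)
    (sepXY : separated_pairing pXY) (sepZW : separated_pairing pZW)
    (adjA : is_adjoint pXY pZW A Aadj)
    (coneP : convex_cone P) (coneQ : convex_cone Q)
    (feasP : primal_feasible A P Q b !=set0)
    (feasD : dual_feasible pXY pZW Aadj P Q c !=set0) :
  calH pXY A P Q b c `&` ([set 0] `*` [set: R]) =
    calN pXY pZW Aadj P Q b c `&` ([set 0] `*` [set: R])
  <->
  primal_attained pXY A P Q b c /\
    primal_value pXY A P Q b c = dual_value pXY pZW Aadj P Q b c.
Proof.
have dualNy : dual_value pXY pZW Aadj P Q b c != -oo%E.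
  case: feasD => w Fw; rewrite -ltNye; apply: (lt_le_trans (ltNyr (pZW b w))).
  by apply: ereal_sup_ubound; exists w.
rewrite setI_axis_eq.
rewrite -(upset_eq_ray (fun x => pXY x c) feasP dualNy).
split=> slices r.
  by rewrite -calH_axis -calN_axis.
by rewrite calH_axis calN_axis.
Qed.
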